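(* Let $\mathbb K$ be a field, $G=([n],E(G))$ a simple graph, $\mathcal S=(S_{ij})$ a family of gain sets on $G$ with values in $\mathbb K$, and let $\pi$ be a nice partition of $\mathcal A(G_{\mathcal S})$. Assume that $G$ is a block. After relabeling the parts of $\pi$, there is an ordering $v_1,\dots,v_n$ of the vertices of $G$ such that $$\pi_i=\bigcup_{j>i}\mathcal A_{v_iv_j}\qquad (i=1,\dots,n-1),$$ with empty unions omitted; that is, the parts of $\pi$ are exactly the nonempty sets among $\bigcup_{j>i}\mathcal A_{v_iv_j}$, $1\le i\le n-1$.
   Context: Gain sets: $\mathcal S=(S_{ij})$ is a family of finite subsets of $\mathbb K$ indexed by ordered pairs of distinct vertices of $G$, with $S_{ji}=-S_{ij}=\{-a\mid a\in S_{ij}\}$ and $S_{ij}\neq\emptyset$ if and only if $ij\in E(G)$. Put $H_{ij}^a=\{x\in\mathbb K^n\mid x_i-x_j=a\}$ and $\mathcal A(G_{\mathcal S})=\{H_{ij}^a\mid a\in S_{ij},\ i<j\}$. For distinct vertices $i,j$, $\mathcal A_{ij}=\{H_{ij}^a\mid a\in S_{ij}\}=\mathcal A_{ji}$ (the parallel class of the edge $ij$; empty if $ij\notin E(G)$). Block: ''$G$ is a block'' means that $G$ is connected and has no cut vertex; the one-vertex graph and the graph consisting of a single edge are included. Intersection poset: for a finite affine arrangement $\mathcal A$ in $V$, $L(\mathcal A)$ consists of $V$ and all nonempty intersections of hyperplanes of $\mathcal A$, ordered by reverse inclusion; the localization at $X\in L(\mathcal A)$ is $\mathcal A_X=\{H\in\mathcal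 A\mid X\subseteq H\}$. Nice partition: let $\pi=(\pi_1,\dots,\pi_s)$ be a partition of an affine arrangement $\mathcal A$ in $V$. A $p$-section of $\pi$ is a set $\{H_1,\dots,H_p\}\subseteq\mathcal A$ no two of whose members lie in the same part; it is independent if $H_1\cap\cdots\cap H_p$ is nonempty of codimension $p$. $\pi$ is independent if every section is independent. $\pi$ is nice if it is independent and, for every $X\in L(\mathcal A)\setminus\{V\}$, there is $i$ with $|\pi_i\cap\mathcal A_X|=1$. The empty partition of the empty arrangement is nice. *)

(* Defs.v *)
From mathcomp Require Import all_boot all_order all_algebra all_fingroup.
From mathcomp Require Import all_classical.

Set Implicit Arguments.
Unset Strict Implicit.
Unset Printing Implicit Defensive.

Import GRing.Theory.
Local Open Scope classical_set_scope.
Local Open Scope ring_scope.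

Section Graphs.
Context {T : finType}.
Implicit Types (e : rel T) (x y z : T).

Definition simple_graph e : Prop := symmetric e /\ irreflexive e.

Definition connected_graph e : Prop :=
  (0 < #|T|)%N /\ forall x y, connect e x y.

Definition delete_vertex e z : rel T :=
  [rel x y | [&& x != z, y != z & e x y]].

(* z separates two other vertices of the same connected component. *)
Definition cut_vertex e z : Prop :=
  exists x y, [/\ x != z, y != z, connect e x y
                & ~~ connect (delete_vertex e z) x y].

Definition block e : Prop :=
  connected_graph e /\ forall z, ~ cut_vertex e z.

End Graphs.

Section AffineArrangements.
Context {K : fieldType} {V : vectType K}.
Implicit Types (X : set V) (A B : set (set V)).

(* X is an affine subspace v + U with U of codimension p; in particular X is
   nonempty. *)
Definition has_codim X (p : nat) : Prop :=
  exists (v : V) (U : {vspace V}),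
    X = [set v + u | u in [set u : V | u \in U]]
    /\ (\dim U + p = \dim {:V})%N.

(* B = set0 contributes the whole space V. *)
Definition intersection_poset A : set (set V) :=
  [set X | X !=set0 /\ exists2 B, B `<=` A & X = \bigcap_(H in B) H].

Definition localization A X : set (set V) := [set H | A H /\ X `<=` H].

Section Partitions.
Context {s : nat}.
Implicit Types pi : 'I_s -> set (set V).

Definition section A pi (p : nat) B : Prop :=
  [/\ B `<=` A, (B #= `I_p)%card
    & forall k H H', B H -> B H' -> pi k H -> pi k H' -> H = H'].

Definition independent_partition A pi : Prop :=
  forall p B, section A pi p B -> has_codim (\bigcap_(H in B) H) p.

(* The parts of a partition are nonempty, by classical_sets.partition; s = 0
   gives the empty partition of the empty arrangement. *)
Definition nice_partition A pi : Prop :=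
  [/\ classical_sets.partition [set: 'I_s] pi A,
      independent_partition A pi
    & forall X, intersection_poset A X -> X <> [set: V] ->
        exists k, (pi k `&` localization A X #= `I_1)%card].

End Partitions.
End AffineArrangements.

Section GainGraphs.
Context {K : fieldType} {n : nat}.
Implicit Types (e : rel 'I_n) (S : 'I_n -> 'I_n -> set K) (i j : 'I_n).

(* The diagonal values S i i are irrelevant: only ordered pairs of distinct
   vertices index the family. *)
Definition gain_sets e S : Prop :=
  forall i j, i != j ->
    [/\ finite_set (S i j),
        S j i = [set - a | a in S i j]
      & S i j !=set0 <-> e i j].

Definition gain_hyperplane i j (a : K) : set 'rV[K]_n :=
  [set x | x ord0 i - x ord0 j = a].

Definition parallel_class S i j : set (set 'rV[K]_n) :=
  [set gain_hyperplane i j a | a in S i j].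

Definition gain_arrangement S : set (set 'rV[K]_n) :=
  [set H | exists i j a,
     [/\ (i < j)%N, S i j a & H = gain_hyperplane i j a]].

End GainGraphs.

(* Main.v *)
Require Import Defs.
From mathcomp Require Import all_boot all_order all_algebra all_fingroup.
From mathcomp Require Import all_classical.

(** Colour each edge of the graph by the part of the partition that contains
    its hyperplanes. This makes sense because two parallel hyperplanes never
    form an independent section, so a parallel class lies in one part. The
    partition being nice forces three properties of the colouring.

    - Two edges of the same colour share a vertex ([same_part_meet]), and two
      edges [xy], [xz] of the same colour span a triangle whose third edge has
      another colour ([same_part_fork]). Indeed, the two hyperplanes [H], [H']
      lie in the same part, and niceness at the flat [H `&` H'] requires a
      third hyperplane through it from another part; it belongs to an edge
      joining two vertices connected by the given edges ([same_part_third]).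
    - No cycle is rainbow ([no_rainbow_cycle]), because on a nonempty
      intersection the equation of one edge of a cycle follows from the
      others, against independence.

    The rest is graph theory. By the first property the colour classes are
    stars with pairwise adjacent leaves. Orient each edge of a star with at
    least two edges from the centre to the leaf. A directed cycle would be
    rainbow, so there is a source ([exists_source]). In a block, all edges at a
    source have the same colour: otherwise a shortest cycle on which the colour
    changes at the source has two consecutive edges of the same colour
    elsewhere, and cutting across the triangle they span shortens it
    ([source_monochromatic]). The source is therefore simplicial, and removing
    it leaves a block. Removing sources one after the other gives the ordering
    ([star_ordering]): the class of the edges at each removed vertex consists
    of its edges to the later vertices. *)

Set Implicit Arguments.
Unset Strict Implicit.
Unset Printing Implicit Defensive.

(** * Edge colourings whose colour classes are stars *)

Section StarColourings.
Local Open Scope nat_scope.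

Context {T : finType} {C : eqType} (e : rel T) (col : T -> T -> C).
Context (e_sym : symmetric e) (e_irr : irreflexive e).
Context (col_sym : forall x y, col x y = col y x).
Context (col_meet : forall x y z w, e x y -> e z w -> col x y = col z w ->
  [|| z == x, z == y, w == x | w == y]).
Context (col_fork : forall x y z, e x y -> e x z -> y != z ->
  col x y = col x z -> e y z /\ col y z != col x y).
Context (col_cycle : forall c, uniq c -> path.cycle e c -> 2 < size c ->
  ~ {in c &, injective (fun a => col a (next c a))}).

Implicit Types (x y z u v w : T) (c p : seq T) (W : {set T}).

Let neq_edge x y : e x y -> x != y.
Proof. by apply: contraTneq => ->; rewrite e_irr. Qed.

(** A colour class with at least two edges is a star whose leaves are pairwise
    joined by edges of other colours, so its centre is determined; [arc x y]
    orients the edges of these stars away from the centre. Classes with a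
    single edge have no distinguished end and give no arcs. In the ordering to
    be built, every arc must point forward. *)
Definition arc x y :=
  e x y && [exists z, [&& e x z, z != y & col x z == col x y]].

Lemma arcP x y z : e x y -> e x z -> y != z -> col x y = col x z -> arc x y.
Proof.
move=> exy exz yz cyz; rewrite /arc exy; apply/existsP; exists z.
by rewrite exz eq_sym yz cyz eqxx.
Qed.

(** An edge of the class missing the centre [x] would have to meet both leaf
    edges [xy] and [xz] at their leaves, hence be [yz], which has another
    colour. *)
Lemma arc_centre x y u w :
  arc x y -> e u w -> col u w = col x y -> (x == u) || (x == w).
Proof.
case/andP=> exy /existsP[z /and3P[exz zy /eqP cz]] euw cuw.
have [//|xu] := eqVneq x u; have [//|xw] := eqVneq x w.
have yz : y != z by rewrite eq_sym.
have [eyz] := col_fork exy exz yz (esym cz).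
have uw := neq_edge euw.
have := col_meet exy euw (esym cuw).
rewrite ![_ == x]eq_sym (negbTE xu) (negbTE xw) /= => muw.
have := col_meet exz euw (etrans cz (esym cuw)).
rewrite ![_ == x]eq_sym (negbTE xu) (negbTE xw) /= => muw'.
case/orP: muw => /eqP e1; case/orP: muw' => /eqP e2; subst.
- by rewrite eqxx in yz.
- by rewrite cuw eqxx.
- by rewrite col_sym cuw eqxx.
- by rewrite eqxx in yz.
Qed.

Lemma arc_inj x y x' y' : arc x y -> arc x' y' -> col x y = col x' y' -> x = x'.
Proof.
move=> axy axy' cc.
have [exy' /existsP[z' /and3P[exz' zy' /eqP cz']]] := andP axy'.
have /orP[/eqP //|/eqP xy'] := arc_centre axy exy' (esym cc).
have /orP[/eqP //|/eqP xz'] := arc_centre axy exz' (etrans cz' (esym cc)).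
by rewrite -xy' xz' eqxx in zy'.
Qed.

(** If every vertex of [W] had an arc coming in from [W], following arcs
    backwards would close up a directed cycle. Its arcs belong to stars with
    distinct centres, so it is rainbow; a directed cycle of length two would
    give one star two centres. *)
Lemma exists_source W : W != finset.set0 ->
  exists2 v, v \in W & forall u, u \in W -> ~~ arc u v.
Proof.
case/set0Pn=> x0 x0W; apply: contrapT => noS.
have pred_arc v : v \in W -> exists2 u, u \in W & arc u v.
  move=> vW; apply: contrapT => noU; apply: noS; exists v => // u uW.
  by apply/negP => auv; apply: noU; exists u.
pose f v := if [pick u | (u \in W) && arc u v] is Some u then u else v.
have fP v : v \in W -> (f v \in W) && arc (f v) v.
  by move=> vW; rewrite /f; case: pickP => [//|no]; have [u uW auv] := pred_arc _ vW;
     move: (no u); rewrite uW auv.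
(* The orbit of [f] cannot get smaller along [f], so a vertex with a smallest
   orbit lies on a cycle of [f]. *)
have [y yW ymin] := arg_minnP (fingraph.order f) x0W.
have fyW : f y \in W by case/andP: (fP _ yW).
have ocyc : fcycle f (fingraph.orbit f y).
  apply/(orbitPcycle 0 1)/eqP; rewrite eqn_leq ymin // andbT.
  apply: subset_leq_card; apply/fintype.subsetP => z; rewrite !inE.
  by apply: connect_trans; apply: fconnect1.
pose c := fingraph.orbit f y.
have cW z : z \in c -> z \in W.
  rewrite -fconnect_orbit => /iter_findex <-.
  by elim: (findex f y z) => //= n IH; case/andP: (fP _ IH).
have nextE z : z \in c -> next c z = f z.
  by move=> zc; apply/esym/eqP; exact: (next_cycle ocyc zc).
have finj : {in c &, injective f} by apply/(orbitPcycle 0 5).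
have colinj : {in c &, injective (fun a => col a (next c a))}.
  move=> a b ac bc; rewrite !nextE // => cab; apply: finj => //.
  have /andP[_ aa] := fP _ (cW _ ac); have /andP[_ ab] := fP _ (cW _ bc).
  by apply: (arc_inj aa ab); rewrite col_sym cab col_sym.
have ecyc : path.cycle e c.
  apply: (sub_in_cycle (P := mem c)) ocyc => [a b ac _ /eqP <-|].
    by have /andP[_ /andP[]] := fP _ (cW _ ac); rewrite e_sym.
  by apply/allP.
have [big|small] := ltnP 2 (size c).
  exact: (col_cycle (orbit_uniq f y) ecyc big colinj).
have yc : y \in c by exact: in_orbit.
have /andP[_ ay] := fP _ yW; have /andP[_ afy] := fP _ fyW.
suff ffy : f (f y) = y.
  rewrite ffy in afy; have yfy := arc_inj ay afy (col_sym _ _).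
  by case/andP: ay; rewrite yfy e_irr.
have := iter_order_cycle ocyc yc yc.
have fyy : f y != y by apply: neq_edge; case/andP: ay.
move: small; rewrite size_orbit.
case: (fingraph.order f y) (fingraph.order_gt0 f y) => [//|[|[|//]]] _ _ /= E.
  by rewrite E eqxx in fyy.
by [].
Qed.

Definition connected_in W := {in W &, forall x y,
  connect [rel a b | [&& a \in W, b \in W & e a b]] x y}.

(** For [z] outside [W] the second condition repeats the first, but [W] may be
    the whole vertex set. *)
Definition block_in W := connected_in W /\ forall z, connected_in (W :\ z).

(** A path through [v] can be shortcut along the edge between the two
    neighbours of [v] that it uses. *)
Lemma connected_in_simplicial W v : connected_in W ->
    {in W &, forall x y, e v x -> e v y -> x != y -> e x y} ->
  connected_in (W :\ v).
Proof.
move=> conW simp x y; rewrite !inE => /andP[xv xW] /andP[yv yW].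
have /connectP[p] := conW x y xW yW.
have [n] := ubnP (size p); elim: n => // n IH in x p xv xW *.
case: p => [|a p] /=; first by move=> _ _ ->; apply: connect0.
rewrite ltnS => lepn /andP[/and3P[_ aW exa] pthp] lasty.
have [av|av] := eqVneq a v; last first.
  apply: (connect_trans (y := a)).
    by apply: connect1; rewrite /= !inE xv av xW aW.
  by apply: (IH a p).
subst a; case: p pthp lepn lasty => [|b p] /=.
  by move=> _ _ E; rewrite E eqxx in yv.
case/andP=> /and3P[_ bW evb] pthp lepn lasty.
have bv : b != v by rewrite eq_sym neq_edge.
have conb : connect [rel a b | [&& a \in W :\ v, b \in W :\ v & e a b]] b y.
  by apply: (IH b p) => //; apply: ltnW.
have [->//|xb] := eqVneq x b; apply: (connect_trans _ conb).
apply: connect1; rewrite /= !inE xv bv xW bW /=.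
by apply: simp => //; rewrite e_sym.
Qed.

Lemma block_in_simplicial W v : block_in W ->
    {in W &, forall x y, e v x -> e v y -> x != y -> e x y} ->
  block_in (W :\ v).
Proof.
move=> [_ conW] simp; split=> [|z]; first exact: conW.
rewrite finset.setDDl finset.setUC -finset.setDDl.
apply: connected_in_simplicial => // x y.
by rewrite !inE => /andP[_ xW] /andP[_ yW]; apply: simp.
Qed.

Lemma next_cat x p1 p2 : uniq (p1 ++ p2) -> next (p1 ++ p2) x = next (p2 ++ p1) x.
Proof. by move=> u; rewrite -(rot_size_cat p1 p2) next_rot. Qed.

(** No cycle is rainbow, and two edges of a cycle with the same colour share a
    vertex, hence are consecutive. *)
Lemma proper_cycle_fork c : uniq c -> path.cycle e c -> 2 < size c ->
  exists2 a, a \in c &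
    col a (next c a) = col (next c a) (next c (next c a)).
Proof.
move=> uc cc sc; apply: contrapT => proper.
have {}proper a : a \in c ->
    col a (next c a) <> col (next c a) (next c (next c a)).
  by move=> ac E; apply: proper; exists a.
apply: (col_cycle uc cc sc) => a b ac bc cab.
have ea := next_cycle cc ac; have eb := next_cycle cc bc.
case/or4P: (col_meet ea eb cab) => /eqP E.
- by [].
- by have := proper a ac; rewrite cab E.
- by have := proper b bc; rewrite -cab E.
- by have := prev_next uc a; rewrite -E prev_next.
Qed.

(** Suppose two edges at [v] have different colours. As [W] minus [v] is
    connected, they lie on a cycle through [v]; take a shortest cycle on which
    the colour changes at [v]. Since it is not rainbow, there are two
    consecutive edges [ab], [bd] of the same colour, meeting at some [b] other
    than [v], and [ad] is then an edge. If [v] is [a] or [d], then [b] is the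
    centre of a star containing [v], which is impossible for a source.
    Otherwise replacing [a], [b], [d] by [a], [d] gives a shorter such
    cycle. *)
Lemma source_monochromatic W v : connected_in (W :\ v) ->
    v \in W -> (forall u, u \in W -> ~~ arc u v) ->
  {in W &, forall x y, e v x -> e v y -> col v x = col v y}.
Proof.
move=> conW vW src x y xW yW evx evy; apply/eqP/contraT => cxy.
have no_cycle p : {subset p <= W} -> uniq (v :: p) -> path.cycle e (v :: p) ->
    1 < size p -> col v (head v p) = col v (last v p).
  have [n] := ubnP (size p); elim: n => // n IH in p *.
  rewrite ltnS => lepn pW up cp sp; apply/eqP/contraT => chl.
  have [a] := proper_cycle_fork up cp sp; rewrite inE => /predU1P[->{a}|].
    (* The two edges meet at the successor of [v]. *)
    case: p lepn pW up cp sp chl => [//|b [//|d p]] _ pW up /= + _ _.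
    rewrite eqxx => /and3P[evb ebd _].
    have [vb vd bd] : [/\ v != b, v != d & b != d].
      by move: up; rewrite /= !inE !negb_or -!andbA => /and5P[-> -> _ ->].
    rewrite [b == v]eq_sym (negbTE vb) eqxx col_sym => cbd.
    have bW : b \in W by apply: pW; rewrite inE eqxx.
    by have /negP[] := src b bW; apply: (@arcP _ _ d) => //; rewrite e_sym.
  move=> ap; case/splitPr: ap lepn pW up cp sp chl => p1 p2 lepn pW up cp sp chl.
  (* Rotating the cycle to start at [a] makes the successors computable. *)
  have step q : next (v :: p1 ++ a :: p2) q = next (a :: p2 ++ v :: p1) q.
    exact: (next_cat q (p1 := v :: p1) up).
  have ua : uniq ((a :: p2) ++ v :: p1) by rewrite uniq_catC.
  rewrite !step /=.
  have : path.cycle e (a :: p2 ++ v :: p1).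
    by rewrite -(rot_cycle (size (a :: p2))) -(cat_cons a) rot_size_cat.
  case: p2 => [|b p2] in lepn pW up cp sp chl step ua *.
    (* The two edges meet at [v] itself. *)
    rewrite /= eqxx; case: p1 => [//|d p1] in lepn pW up cp sp chl step ua *.
    move=> _; move: ua; rewrite /= !inE !negb_or => /andP[/and3P[av ad _] _].
    rewrite eq_sym in av; rewrite (negbTE av) eqxx.
    by move=> cav; move: chl; rewrite last_cat /= [col v a]col_sym cav eqxx.
  rewrite /= eqxx; case: p2 => [|d p2] in lepn pW up cp sp chl step ua *.
    (* The two edges meet at the predecessor of [v]. *)
    move=> /= /and3P[eab ebv _].
    move: ua; rewrite /= !inE !negb_or => /andP[/and3P[ab av _] /andP[/andP[bv _] _]].
    rewrite eq_sym in ab; rewrite (negbTE ab) eqxx col_sym => cab.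
    have bW : b \in W by apply: pW; rewrite mem_cat !inE eqxx !orbT.
    have /negP[] := src b bW; apply: (@arcP _ _ a) => //;
      by [rewrite e_sym | rewrite eq_sym].
  move=> /= /and3P[eab ebd _].
  move: ua; rewrite /= !inE !negb_or => /andP[/and3P[ab ad _] _].
  rewrite eq_sym in ab; rewrite (negbTE ab) eqxx col_sym => cab.
  rewrite e_sym in eab.
  have [ead _] := col_fork eab ebd ad cab.
  have sub : subseq (p1 ++ [:: a, d & p2]) (p1 ++ [:: a, b, d & p2]).
    by rewrite cat_subseq // -(cat1s a (d :: p2)) -(cat1s a [:: b, d & p2])
      cat_subseq // subseq_cons.
  have := IH (p1 ++ [:: a, d & p2]).
  have -> : last v (p1 ++ [:: a, d & p2]) = last v (p1 ++ [:: a, b, d & p2]).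
    by rewrite !last_cat.
  have -> : head v (p1 ++ [:: a, d & p2]) = head v (p1 ++ [:: a, b, d & p2]).
    by case: (p1).
  move=> shorter; rewrite shorter ?eqxx // in chl.
  - by apply: leq_trans lepn; rewrite !size_cat ltn_add2l.
  - by move=> q /(mem_subseq sub)/pW.
  - by apply: subseq_uniq up; rewrite /= eqxx.
  - move: cp; rewrite /= !rcons_cat !cat_path /= => /andP[-> /and4P[-> _ _ ->]].
    by rewrite ead.
  - by rewrite size_cat /= !addnS.
have xWv : x \in W :\ v by rewrite !inE xW eq_sym neq_edge.
have yWv : y \in W :\ v by rewrite !inE yW eq_sym neq_edge.
have /connectP[p0 pth0 lst] := conW x y xWv yWv.
case/shortenP: pth0 lst => p pth up _ lst; subst y.
have pWv : {subset x :: p <= W :\ v}.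
  move=> q; rewrite inE => /predU1P[->//|].
  elim: p (x) pth {xW evx cxy xWv up evy yW yWv} => //= z p IH w /andP[/and3P[_ zW _] pth].
  by rewrite inE => /predU1P[->//|]; apply: IH pth.
have sp : 0 < size p by case: (p) cxy => //=; rewrite eqxx.
suff E : col v x = col v (last x p) by rewrite E eqxx in cxy.
apply: (no_cycle (x :: p)) => [q /pWv||/=|//].
- by rewrite inE => /andP[].
- move: up => /= ->; rewrite andbT; apply/negP => /pWv.
  by rewrite !inE eqxx.
- rewrite evx rcons_path e_sym evy andbT /=.
  by apply: sub_path pth => a b /and3P[].
Qed.

(** Otherwise [y] would separate [v] from any third vertex. *)
Lemma block_in_unique_neighbour W v y : block_in W -> v \in W -> y \in W ->
    e v y -> (forall z, z \in W -> e v z -> z = y) ->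
  W = [set v; y]%SET.
Proof.
move=> [_ conW] vW yW evy only; apply/setP => t; rewrite !inE.
apply/idP/idP => [tW|/orP[] /eqP-> //].
apply: contraT; rewrite negb_or => /andP[tv ty].
have vWy : v \in W :\ y by rewrite !inE vW neq_edge.
have tWy : t \in W :\ y by rewrite !inE tW ty.
have /connectP[[|a p] /= pth lst] := conW y v t vWy tWy.
  by rewrite lst eqxx in tv.
case/andP: pth => /and3P[_ aWy eva] _.
by have [/eqP ay aW] := setD1P aWy; case: ay; apply: only.
Qed.

(** The ordering starts with a source [v]. Its edges have a single colour, so
    its neighbours form a clique and the rest of [W] is still a block, which is
    ordered by induction. *)
Lemma star_ordering W : block_in W -> exists s : seq T,
  [/\ uniq s, s =i W
    & forall x y z w, y \in W -> w \in W -> e x y -> e z w ->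
        index x s < index y s -> index z s < index w s ->
        (col x y == col z w) = (x == z)].
Proof.
have [n] := ubnP #|W|; elim: n => // n IH in W *.
rewrite ltnS => leW blkW.
have [->|/exists_source[v vW src]] := eqVneq W finset.set0.
  by exists [::]; split=> [//|x|x y z w]; rewrite !inE.
have mono := source_monochromatic (blkW.2 v) vW src.
have blkW' : block_in (W :\ v).
  apply: block_in_simplicial => // x y xW yW evx evy xy.
  by have [] := col_fork evx evy xy (mono x y xW yW evx evy).
have [|s [us sW ord]] := IH _ _ blkW'.
  by rewrite (cardsD1 v) vW in leW.
(* The colour of the edges at [v] does not occur among the later vertices: if
   [v] has two neighbours, it is the centre of their star; if it has only one,
   there is just one later vertex. *)
have own y z w : y \in W :\ v -> w \in W :\ v -> z \in W :\ v ->
    e v y -> e z w -> col v y != col z w.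
  move=> yW' wW' zW' evy ezw; apply/eqP => cvy.
  have [yv yW] := setD1P yW'; have [wv wW] := setD1P wW'.
  have [zv zW] := setD1P zW'.
  have [/existsP[t /and3P[tW evt ty]]|/existsPn only] :=
    boolP [exists t, [&& t \in W, e v t & t != y]].
    have avy : arc v y.
      by apply: (arcP evy evt); rewrite 1?eq_sym //; apply: mono.
    have := arc_centre avy ezw (esym cvy).
    by rewrite ![v == _]eq_sym (negbTE zv) (negbTE wv).
  have WE : W = [set v; y]%SET.
    apply: block_in_unique_neighbour => // t tW evt; apply/eqP.
    by move: (only t); rewrite tW evt negbK.
  move: (neq_edge ezw) zW wW; rewrite WE !inE (negbTE zv) (negbTE wv) /=.
  by move=> + /eqP zy /eqP wy; rewrite zy wy eqxx.
exists (v :: s); split.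
- by rewrite /= us sW !inE eqxx.
- by move=> x; rewrite !inE sW !inE; case: eqVneq => // ->.
move=> x y z w yW wW exy ezw /=.
have [vy|vy] := eqVneq v y; first by rewrite ltn0.
have [vw|vw] := eqVneq v w; first by rewrite (ltn0 (if _ then _ else _)).
have yW' : y \in W :\ v by rewrite !inE eq_sym vy.
have wW' : w \in W :\ v by rewrite !inE eq_sym vw.
have before t u : index t s < index u s -> t \in W :\ v.
  by move=> lt; rewrite -sW -index_mem (leq_trans lt) // index_size.
have [vx|vx] := eqVneq v x; have [vz|vz] := eqVneq v z; rewrite ?ltnS.
- subst x; subst z; move=> _ _; rewrite eqxx; apply/eqP.
  by apply: mono.
- subst x => _ /before zW'; rewrite (negbTE vz); apply/negbTE.
  by apply: own.
- subst z => /before xW' _; rewrite eq_sym [x == v]eq_sym (negbTE vx).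
  by apply/negbTE; apply: own.
- by move=> lxy lzw; apply: ord.
Qed.

End StarColourings.

Import GRing.Theory.
Local Open Scope classical_set_scope.
Local Open Scope ring_scope.

(** * Nice partitions of affine arrangements *)

Lemma card_image_seq (I : choiceType) (U : Type) (h : I -> U) (c : seq I) :
  uniq c -> {in c &, injective h} ->
  ([set h x | x in [set` c]] #= `I_(size c))%card.
Proof.
move=> uc hinj; apply: (@card_eq_trans _ _ _ _ [set` c]).
  by apply: inj_card_eq => x y; rewrite !inE /=; apply: hinj.
apply/pcard_eqP/bijPex; exists (index^~ c); split=> [x /=|x y|i /= ic].
- by rewrite index_mem.
- by rewrite !inE /= => xc yc; apply: index_inj.
- case: c uc hinj ic => [//|x0 c] uc _ ic.
  by exists (nth x0 (x0 :: c) i); [apply: mem_nth|apply: index_uniq].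
Qed.

Lemma card_eq1_inj (T : Type) (A : set T) x y :
  (A #= `I_1)%card -> A x -> A y -> x = y.
Proof.
move=> /pcard_eqP/bijPex[f [f01 finj _]] Ax Ay.
apply: finj; rewrite ?inE //.
by move: (f01 _ Ax) (f01 _ Ay); rewrite /= !ltnS !leqn0 => /eqP-> /eqP->.
Qed.

Lemma card_eq1_nonempty (T : Type) (A : set T) : (A #= `I_1)%card -> A !=set0.
Proof.
move=> A1; apply/set0P/eqP => A0; move: A1; rewrite A0.
by move=> /pcard_eqP/bijPex[f [_ _ /(_ 0%N)[]]].
Qed.

Section AffineFacts.
Context {K : fieldType} {V : vectType K}.
Implicit Types (X : set V) (A : set (set V)).

Lemma has_codim_nonempty X p : has_codim X p -> X !=set0.
Proof.
by move=> [v [U [-> _]]]; exists v; exists 0; rewrite ?addr0 //= mem0v.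
Qed.

Lemma has_codim_inj X p q : has_codim X p -> has_codim X q -> p = q.
Proof.
have direction v v' (U U' : {vspace V}) :
    [set v + u | u in [set u : V | u \in U]] `<=`
    [set v' + u | u in [set u : V | u \in U']] -> (U <= U')%VS.
  move=> sub; apply/subvP => u uU.
  have [u0 /= u0U' e0] : [set v' + u | u in [set u : V | u \in U']] v.
    by apply: sub; exists 0; rewrite ?addr0 //= mem0v.
  have [u1 /= u1U' e1] : [set v' + u | u in [set u : V | u \in U']] (v + u).
    by apply: sub; exists u.
  suff -> : u = u1 - u0 by rewrite memvB.
  by apply: (addrI v); rewrite -e1 -e0 addrACA subrr addr0.
move=> [v [U [XU dU]]] [v' [U' [XU' dU']]].
have UU' : U = U'.
  apply/eqP; rewrite eqEsubv; apply/andP; split.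
  - by apply: (direction v v'); rewrite -XU -XU'.
  - by apply: (direction v' v); rewrite -XU -XU'.
by apply/eqP; rewrite -(eqn_add2l (\dim U)) dU UU' dU'.
Qed.

Context {s : nat} (A : set (set V)) (pi : 'I_s -> set (set V)).
Context (nice : nice_partition A pi).

Lemma part_exists H : A H -> exists k, pi k H.
Proof. by case: nice => [[<- _ _] _ _] [k _ kH]; exists k. Qed.

Lemma part_sub k H : pi k H -> A H.
Proof. by case: nice => [[<- _ _] _ _] kH; exists k. Qed.

Lemma part_unique k k' H : pi k H -> pi k' H -> k = k'.
Proof. by case: nice => [[_ triv _] _ _] kH k'H; apply: triv => //; exists H. Qed.

Lemma part_nonempty k : pi k !=set0.
Proof. by case: nice => [[_ _ ne] _ _]; apply: ne. Qed.

(** Independence, for sections given as indexed families. *)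
Lemma section_codim (I : choiceType) (h : I -> set V) (c : seq I) :
    uniq c -> {in c, forall x, A (h x)} ->
    {in c &, forall x y, forall k, pi k (h x) -> pi k (h y) -> x = y} ->
  has_codim (\bigcap_(x in [set` c]) h x) (size c).
Proof.
move=> uc cA cpi; rewrite -(bigcap_image _ h id); case: nice => _ indep _.
apply: indep; split=> [_ [x /= xc <-]||k _ _ [x /= xc <-] [y /= yc <-] kx ky].
- exact: cA.
- apply: card_image_seq => // x y xc yc hxy.
  have [k kx] := part_exists (cA x xc).
  by apply: (cpi x y xc yc k) => //; rewrite -hxy.
- by rewrite (cpi x y xc yc k).
Qed.

(** In different parts the two would form a section with empty
    intersection. *)
Lemma disjoint_same_part H H' k : A H' -> H `&` H' = set0 -> pi k H -> pi k H'.
Proof.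
move=> AH' disj kH; apply: contrapT => nkH'.
pose h b := if b then H else H'.
have /has_codim_nonempty[p capp] :
    has_codim (\bigcap_(b in [set` [:: true; false]]) h b) 2.
  apply: section_codim => [//|[] _ /=|]; [exact: part_sub kH|done|].
  case=> [] [] _ _ //= l lH lH'; case: nkH'.
    by rewrite (part_unique kH lH).
  by rewrite (part_unique kH lH').
have : (H `&` H') p by split; [apply: (capp true)|apply: (capp false)].
by rewrite disj.
Qed.

(** Niceness at the flat [H `&` H'] provides a part with exactly one hyperplane
    through it. That part is not [pi k], which contains two. *)
Lemma same_part_third H H' k : pi k H -> pi k H' -> H <> H' ->
    H `&` H' !=set0 ->
  exists H'', [/\ A H'', ~ pi k H'' & H `&` H' `<=` H''].
Proof.
move=> kH kH' HH' ne; case: nice => _ _ /(_ (H `&` H')) [||k' single].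
- split=> //; exists [set H; H'].
    by move=> _ [] ->; [exact: part_sub kH|exact: part_sub kH'].
  by rewrite bigcap_setU !bigcap_set1.
- move=> HT; apply: HH'.
  by apply: (@eq_trans _ _ setT); apply/seteqP; split=> // x _;
     have [] : (H `&` H') x by rewrite HT.
have [H'' [kH'' [AH'' sub]]] := card_eq1_nonempty single.
exists H''; split=> // kH2; have kk' := part_unique kH2 kH''.
subst k'; apply: HH'; apply: (card_eq1_inj single); split=> //; split.
- exact: part_sub kH.
- exact: subIsetl.
- exact: part_sub kH'.
- exact: subIsetr.
Qed.

End AffineFacts.

(** * The edge colouring defined by a nice partition *)

Section GainFacts.
Context {K : fieldType} {n : nat} {e : rel 'I_n} {S : 'I_n -> 'I_n -> set K}.
Context (simple_e : simple_graph e) (gains : gain_sets e S).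
Implicit Types (i j x y z w : 'I_n) (g h : K).

Lemma edge_neq i j : e i j -> i != j.
Proof. by apply: contraTneq => ->; rewrite simple_e.2. Qed.

Lemma gain_edge i j a : i != j -> S i j a -> e i j.
Proof. by move=> /gains[_ _ <-] Sa; exists a. Qed.

Lemma edge_gain i j : e i j -> exists a, S i j a.
Proof. by move=> eij; have [_ _ [_]] := gains (edge_neq eij); apply. Qed.

Lemma gain_opp i j a : i != j -> S i j a -> S j i (- a).
Proof. by move=> /gains[_ -> _] Sa; exists a. Qed.

Lemma gain_hyperplane_opp i j (a : K) :
  gain_hyperplane j i (- a) = gain_hyperplane i j a.
Proof.
rewrite /gain_hyperplane; apply/seteqP; split=> p /= E.
  by rewrite -opprB E opprK.
by rewrite -opprB E.
Qed.

Lemma parallel_class_sym i j :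
  parallel_class S i j = parallel_class S j i.
Proof.
have [->//|ij] := eqVneq i j.
suff sub x y : x != y -> parallel_class S x y `<=` parallel_class S y x.
  by apply/seteqP; split; apply: sub; rewrite // eq_sym.
move=> xy _ [a Sa <-]; exists (- a); first exact: gain_opp.
exact: gain_hyperplane_opp.
Qed.

Lemma mem_gain_arrangement i j a :
  i != j -> S i j a -> gain_arrangement S (gain_hyperplane i j a).
Proof.
move=> ij Sa; have [lt|gt|/val_inj E] := ltngtP i j.
- by exists i, j, a.
- by exists j, i, (- a); rewrite gain_hyperplane_opp; split=> //; apply: gain_opp.
- by rewrite E eqxx in ij.
Qed.

(** Translating a point [p] of the intersection by the indicator vector of [P]
    keeps it in the intersection, hence in the third hyperplane. *)
Lemma flat_indicator x y z w i j g h (a : K) (p : 'rV[K]_n) (P : pred 'I_n) :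
    gain_hyperplane x y g p -> gain_hyperplane z w h p ->
    gain_hyperplane x y g `&` gain_hyperplane z w h `<=` gain_hyperplane i j a ->
  P x = P y -> P z = P w -> P i = P j.
Proof.
move=> pg ph sub Pxy Pzw; pose q := p + \row_t (P t)%:R.
have qE t u b : gain_hyperplane t u b p ->
    q ord0 t - q ord0 u = b + ((P t)%:R - (P u)%:R).
  by move=> pb; rewrite !mxE opprD addrACA pb.
have pij : gain_hyperplane i j a p by apply: sub.
have qij : gain_hyperplane i j a q.
  by apply: sub; rewrite /gain_hyperplane /= (qE _ _ _ pg) (qE _ _ _ ph)
    Pxy Pzw !subrr !addr0.
move: qij; rewrite /gain_hyperplane /= (qE _ _ _ pij) -[RHS]addr0.
move=> /addrI/eqP; rewrite subr_eq0.
by case: (P i) (P j) => [] [] //; rewrite ?oner_eq0 // eq_sym oner_eq0.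
Qed.

Context {s : nat} (pi : 'I_s -> set (set 'rV[K]_n)).
Context (nice : nice_partition (gain_arrangement S) pi).

(** Parallel hyperplanes lie in the same part, so a part containing one
    hyperplane of the edge [ij] contains its whole parallel class. The option is
    [None] only for non-edges. *)
Definition edge_part i j : option 'I_s :=
  [pick k | `[< pi k `&` parallel_class S i j !=set0 >]].

Lemma edge_part_sym i j : edge_part i j = edge_part j i.
Proof. by rewrite /edge_part parallel_class_sym. Qed.

Lemma parallel_same_part i j a b k : i != j -> S i j a -> S i j b ->
  pi k (gain_hyperplane i j a) -> pi k (gain_hyperplane i j b).
Proof.
move=> ij Sa Sb; have [-> //|ab] := eqVneq a b.
apply: (disjoint_same_part nice); first exact: mem_gain_arrangement.
apply/seteqP; split=> // p [/= pa pb].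
by rewrite -pa -pb eqxx in ab.
Qed.

Lemma edge_partP i j a k : i != j -> S i j a ->
  (edge_part i j = Some k) <-> pi k (gain_hyperplane i j a).
Proof.
move=> ij Sa; rewrite /edge_part; case: pickP => [k' /asboolP|no].
  move=> [H [k'H [b Sb E]]]; rewrite -{}E in k'H.
  have k'a := parallel_same_part ij Sb Sa k'H.
  by split=> [[<-]//|ka]; rewrite (part_unique nice ka k'a).
split=> // ka; move/asboolP: (no k); case.
by exists (gain_hyperplane i j a); split=> //; exists a.
Qed.

Lemma edge_part_some i j : e i j -> exists k, edge_part i j = Some k.
Proof.
move=> eij; have [a Sa] := edge_gain eij; have ij := edge_neq eij.
have [k ka] := part_exists nice (mem_gain_arrangement ij Sa).
by exists k; apply/(edge_partP _ ij Sa).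
Qed.

(** The edge [ij] of a third hyperplane through the intersection of two
    hyperplanes of the same part. The last clause says that [i] and [j] are
    connected by the edges [xy] and [zw]; the predicate [Q] only serves to tell
    these two edges, and thereby the two hyperplanes, apart. *)
Lemma same_part_edges x y z w g h (p : 'rV[K]_n) (Q : pred 'I_n) :
    e x y -> e z w -> S x y g -> S z w h ->
    edge_part x y = edge_part z w ->
    gain_hyperplane x y g p -> gain_hyperplane z w h p ->
    Q x = Q y -> Q z != Q w ->
  exists i j, [/\ e i j, edge_part i j != edge_part x y
    & forall P : pred 'I_n, P x = P y -> P z = P w -> P i = P j].
Proof.
move=> exy ezw Sg Sh cc pg ph Qxy Qzw.
have xy := edge_neq exy; have zw := edge_neq ezw.
have [k kxy] := edge_part_some exy.
have kg : pi k (gain_hyperplane x y g) by apply/(edge_partP _ xy Sg).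
have kh : pi k (gain_hyperplane z w h) by apply/(edge_partP _ zw Sh); rewrite -cc.
have [E||H [[i [j [a [ij Sa ->]]]] nk sub]] := same_part_third nice kg kh.
- move/eqP: Qzw; apply; apply: (flat_indicator (P := Q) pg pg _ Qxy Qxy).
  by rewrite E setIid; apply: subset_refl.
- by exists p.
have {}ij : i != j by apply: contraTneq ij => ->; rewrite ltnn.
exists i, j; split; first exact: gain_edge Sa.
- by rewrite kxy; apply/eqP => /(edge_partP _ ij Sa)/nk.
- by move=> P; apply: (flat_indicator pg ph sub).
Qed.

(** For disjoint edges [xy] and [zw] the only pairs of connected vertices are
    these two edges themselves, and both have the excluded colour. *)
Lemma same_part_meet x y z w : e x y -> e z w ->
  edge_part x y = edge_part z w -> [|| z == x, z == y, w == x | w == y].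
Proof.
move=> exy ezw cc; apply: contraT.
rewrite !negb_or => /and4P[zx zy wx wy].
have [g Sg] := edge_gain exy; have [h Sh] := edge_gain ezw.
have xy := edge_neq exy; have zw := edge_neq ezw.
pose p : 'rV[K]_n := \row_t (if t == x then g else if t == z then h else 0).
have pg : gain_hyperplane x y g p.
  rewrite /gain_hyperplane /= !mxE eqxx [y == x]eq_sym (negbTE xy).
  by rewrite [y == z]eq_sym (negbTE zy) subr0.
have ph : gain_hyperplane z w h p.
  rewrite /gain_hyperplane /= !mxE (negbTE zx) eqxx (negbTE wx).
  by rewrite [w == z]eq_sym (negbTE zw) subr0.
have [||i [j [eij cij sep]]] :=
  same_part_edges (Q := pred1 z) exy ezw Sg Sh cc pg ph.
- by rewrite /= ![_ == z]eq_sym (negbTE zx) (negbTE zy).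
- by rewrite /= eqxx [w == z]eq_sym (negbTE zw).
have ij := edge_neq eij.
have := sep (pred2 x y); have := sep (pred2 z w).
rewrite /= !eqxx !orbT (negbTE zx) (negbTE zy) (negbTE wx) (negbTE wy).
rewrite ![x == _]eq_sym ![y == _]eq_sym (negbTE zx) (negbTE zy) (negbTE wx) (negbTE wy).
move=> /(_ erefl erefl) Dzw /(_ erefl erefl) Dxy.
have [ix|ix] := eqVneq i x.
  move: Dxy; rewrite ix eqxx /= => /esym/orP[/eqP jx|/eqP jy].
    by rewrite ix jx eqxx in ij.
  by rewrite ix jy eqxx in cij.
have [iy|iy] := eqVneq i y.
  move: Dxy; rewrite iy eqxx orbT => /esym/orP[/eqP jx|/eqP jy].
    by rewrite iy jx edge_part_sym eqxx in cij.
  by rewrite iy jy eqxx in ij.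
have [iz|iz] := eqVneq i z.
  move: Dzw; rewrite iz eqxx /= => /esym/orP[/eqP jz|/eqP jw].
    by rewrite iz jz eqxx in ij.
  by rewrite iz jw cc eqxx in cij.
have [iw|iw] := eqVneq i w.
  move: Dzw; rewrite iw eqxx orbT => /esym/orP[/eqP jz|/eqP jw].
    by rewrite iw jz edge_part_sym cc eqxx in cij.
  by rewrite iw jw eqxx in ij.
have := sep (pred1 i); rewrite /= eqxx [x == i]eq_sym [y == i]eq_sym [z == i]eq_sym.
rewrite [w == i]eq_sym [j == i]eq_sym (negbTE ij) (negbTE ix) (negbTE iy)
  (negbTE iz) (negbTE iw).
by move=> /(_ erefl erefl).
Qed.

(** The vertices connected by [xy] and [xz] are [x], [y] and [z], and the edge of
    the third hyperplane is neither [xy] nor [xz] because its colour differs. *)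
Lemma same_part_fork x y z : e x y -> e x z -> y != z ->
  edge_part x y = edge_part x z -> e y z /\ edge_part y z != edge_part x y.
Proof.
move=> exy exz yz cc.
have [g Sg] := edge_gain exy; have [h Sh] := edge_gain exz.
have xy := edge_neq exy; have xz := edge_neq exz.
pose p : 'rV[K]_n := \row_t (if t == y then - g else if t == z then - h else 0).
have pg : gain_hyperplane x y g p.
  by rewrite /gain_hyperplane /= !mxE eqxx (negbTE xy) (negbTE xz) sub0r opprK.
have ph : gain_hyperplane x z h p.
  rewrite /gain_hyperplane /= !mxE eqxx [z == y]eq_sym (negbTE yz).
  by rewrite (negbTE xy) (negbTE xz) sub0r opprK.
have [||i [j [eij cij sep]]] :=
  same_part_edges (Q := pred1 z) exy exz Sg Sh cc pg ph.
- by rewrite /= (negbTE xz) (negbTE yz).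
- by rewrite /= eqxx (negbTE xz).
have ij := edge_neq eij.
have inside t : (pred1 t i = pred1 t j -> False) ->
  t \in [:: x; y; z].
  move=> no; apply: contraT; rewrite !inE !negb_or => /and3P[tx ty tz].
  by case: no; apply: sep;
     rewrite /= [x == t]eq_sym (negbTE tx) eq_sym ?(negbTE ty) ?(negbTE tz).
have : i \in [:: x; y; z].
  by apply: (inside i); rewrite /= eqxx [j == i]eq_sym (negbTE ij).
have : j \in [:: x; y; z].
  by apply: inside; rewrite /= eqxx (negbTE ij).
rewrite !inE => /or3P[] /eqP jE /or3P[] /eqP iE; subst; rewrite ?eqxx // in ij cij *.
- by rewrite edge_part_sym eqxx in cij.
- by rewrite edge_part_sym cc eqxx in cij.
- by rewrite simple_e.1 edge_part_sym.
- by rewrite cc eqxx in cij.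
Qed.

(** One hyperplane for each edge of a rainbow cycle is a section, so the
    intersection is nonempty of codimension the length of the cycle. Omitting
    one hyperplane leaves a section of smaller codimension, but does not change
    the intersection: going around the cycle, the remaining equations determine
    the difference in the omitted one, and its value is the right one since the
    full intersection is nonempty. *)
Lemma no_rainbow_cycle (c : seq 'I_n) :
    uniq c -> path.cycle e c -> (2 < size c)%N ->
  ~ {in c &, injective (fun a => edge_part a (next c a))}.
Proof.
move=> uc cc sc inj.
pose g a := xget 0 (S a (next c a)).
have ne a : a \in c -> a != next c a by move=> /(next_cycle cc)/edge_neq.
have Sg a : a \in c -> S a (next c a) (g a).
  by move=> /(next_cycle cc)/edge_gain; apply: xgetPex.
pose H a := gain_hyperplane a (next c a) (g a).
have codim d : {subset d <= c} -> uniq d ->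
    has_codim (\bigcap_(a in [set` d]) H a) (size d).
  move=> dc ud; apply: (section_codim nice) => // [a /dc ac|a b /dc ac /dc bc k].
    exact: mem_gain_arrangement (ne a ac) (Sg a ac).
  move=> /(edge_partP _ (ne a ac) (Sg a ac)) ka.
  move=> /(edge_partP _ (ne b bc) (Sg b bc)) kb.
  by apply: inj; rewrite // ka kb.
case: c => [//|a0 d] in uc cc sc inj g ne Sg H codim *.
have full := codim (a0 :: d) (fun _ => id) uc.
have dc : {subset d <= a0 :: d} by move=> a ad; rewrite inE ad orbT.
have ud : uniq d by case/andP: uc.
have [p pH] := has_codim_nonempty full.
suff E : \bigcap_(a in [set` a0 :: d]) H a = \bigcap_(a in [set` d]) H a.
  have := has_codim_inj full; rewrite E => /(_ _ (codim d dc ud)) /=.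
  by move/eqP; rewrite eqn_leq ltnn.
apply/seteqP; split=> q qH a /=; first by move=> /dc ac; apply: qH.
rewrite inE => /predU1P[->{a}|]; last by apply: qH.
(* The difference [f] of a point [q] satisfying the other equations and a
   point [p] satisfying all is constant along the rest of the cycle. *)
pose f a := q ord0 a - p ord0 a.
have fE a : a \in a0 :: d -> H a q <-> f a = f (next (a0 :: d) a).
  move=> ac; rewrite /H /gain_hyperplane /f /=; set b := next_at _ _ _ _.
  have <- : p ord0 a - p ord0 b = g a by apply: pH.
  apply: (iff_trans (rwP eqP)); apply: iff_trans (iff_sym (rwP eqP)).
  by rewrite !subr_eq ![_ - _ + _]addrAC [p _ _ + _]addrC.
have walk b r : fpath (next (a0 :: d)) b (rcons r a0) ->
    {subset b :: r <= d} -> f b = f a0.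
  elim: r b => [|b' r IH] b /=.
    rewrite andbT => /eqP nb sub; rewrite -nb.
    have bd : b \in d by apply: sub; rewrite inE.
    by apply/(fE _ (dc _ bd))/qH.
  move=> /andP[/eqP nb pth] sub; rewrite (_ : f b = f b').
    by apply: IH => // t tr; apply: sub; rewrite inE tr orbT.
  have bd : b \in d by apply: sub; rewrite inE eqxx.
  by rewrite -nb; apply/(fE _ (dc _ bd))/qH.
apply/fE; first by rewrite inE eqxx.
have round : fpath (next (a0 :: d)) a0 (rcons d a0) by exact: cycle_next uc.
have [b [r dE]] : exists b r, d = b :: r by case: (d) sc => // b r; exists b, r.
move: round; rewrite [in rcons _ _]dE rcons_cons => /andP[/eqP -> pth].
by apply/esym/(walk b r pth) => t; rewrite -dE.
Qed.

End GainFacts.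
Arguments edge_part {K n} S {s} pi i j.

(** * The vertex ordering *)

Lemma block_in_setT (T : finType) (e : rel T) : block e -> block_in e [set: T]%SET.
Proof.
move=> [[_ conn] nocut]; split=> [x y _ _|z x y].
  by rewrite (eq_connect (e' := e)) // => a b; rewrite /= !inE.
rewrite !inE !andbT => xz yz.
rewrite (eq_connect (e' := delete_vertex e z)).
  by apply: contraT => ncon; case: (nocut z); exists x, y.
by move=> a b; rewrite /= !inE !andbT.
Qed.

Lemma perm_lt_neq n (v : {perm 'I_n}) (i j : 'I_n) :
  (i < j)%N -> v i != v j.
Proof. by move=> ij; rewrite (inj_eq perm_inj) neq_ltn ij. Qed.

Lemma perm_of_seq n (s : seq 'I_n) : uniq s -> s =i [set: 'I_n]%SET ->
  exists v : {perm 'I_n}, forall i, index (v i) s = i.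
Proof.
move=> us sT.
have ss : size s = n by rewrite -(card_uniqP us) -[RHS]card_ord (eq_card sT) cardsT.
have idx i : index (nth i s i) s = i by apply: index_uniq; rewrite ?ss.
have inj : injective (fun i : 'I_n => nth i s i).
  by move=> i j /(congr1 (index^~ s)); rewrite !idx => /val_inj.
by exists (perm inj) => i; rewrite permE.
Qed.

Section Ordering.
Context {K : fieldType} {n : nat} {e : rel 'I_n} {S : 'I_n -> 'I_n -> set K}.
Context (simple_e : simple_graph e) (gains : gain_sets e S).
Context {s : nat} (pi : 'I_s -> set (set 'rV[K]_n)).
Context (nice : nice_partition (gain_arrangement S) pi).
Implicit Types (i j k l : 'I_n) (v : {perm 'I_n}).

Lemma part_ordering : block e -> exists v, forall i j k l, (i < j)%N -> (k < l)%N ->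
  e (v i) (v j) -> e (v k) (v l) ->
  (edge_part S pi (v i) (v j) == edge_part S pi (v k) (v l)) = (i == k).
Proof.
move=> /block_in_setT blk.
have [r [ur rT ord]] := star_ordering simple_e.1 simple_e.2
  (edge_part_sym gains pi) (same_part_meet simple_e gains nice)
  (same_part_fork simple_e gains nice) (no_rainbow_cycle simple_e gains nice) blk.
have [v vr] := perm_of_seq ur rT; exists v => i j k l ij kl eij ekl.
by rewrite ord ?inE ?vr // (inj_eq perm_inj).
Qed.

Lemma gain_arrangement_perm v H : gain_arrangement S H ->
  exists i j a, [/\ (i < j)%N, S (v i) (v j) a & H = gain_hyperplane (v i) (v j) a].
Proof.
move=> [x [y [a [xy Sa ->]]]].
have {}xy : x != y by apply: contraTneq xy => ->; rewrite ltnn.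
rewrite -(permKV v x) -(permKV v y) in xy Sa *.
move: (v^-1%g x) (v^-1%g y) => i j in xy Sa *.
have [ij|ji|/val_inj E] := ltngtP i j.
- by exists i, j, a.
- exists j, i, (- a); split=> //; first exact: (gain_opp gains xy Sa).
  by rewrite gain_hyperplane_opp.
- by rewrite E eqxx in xy.
Qed.

Lemma part_eq_star v i j q :
    (forall i j k l, (i < j)%N -> (k < l)%N ->
      e (v i) (v j) -> e (v k) (v l) ->
      (edge_part S pi (v i) (v j) == edge_part S pi (v k) (v l)) = (i == k)) ->
    (i < j)%N -> e (v i) (v j) -> edge_part S pi (v i) (v j) = Some q ->
  pi q = \bigcup_(j in [set j : 'I_n | (i < j)%N]) parallel_class S (v i) (v j).
Proof.
move=> ord ij eij cij.
apply/seteqP; split=> [H qH|_ [l /= il [a Sa <-]]].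
  have [k [l [a [kl Sa HE]]]] := gain_arrangement_perm v (part_sub nice qH).
  have ekl := gain_edge gains (perm_lt_neq v kl) Sa.
  have ckl : edge_part S pi (v k) (v l) = Some q.
    by apply/(edge_partP gains nice _ (perm_lt_neq v kl) Sa); rewrite -HE.
  have := ord i j k l ij kl eij ekl; rewrite cij ckl eqxx => /esym/eqP ik.
  by subst k; exists l => //; exists a.
apply/(edge_partP gains nice _ (perm_lt_neq v il) Sa); rewrite -cij; apply/eqP.
by rewrite ord ?eqxx //; apply: gain_edge Sa => //; apply: perm_lt_neq.
Qed.

End Ordering.

Theorem proposition3p6 (K : fieldType) (n : nat) (e : rel 'I_n)
    (S : 'I_n -> 'I_n -> set K)
    (s : nat) (pi : 'I_s -> set (set 'rV[K]_n))
    (He : simple_graph e) (HS : gain_sets e S)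
    (Hpi : nice_partition (gain_arrangement S) pi)
    (Hblock : block e) :
  (* vertices are indexed from 0, so i = 1, ..., n - 1 becomes i.+1 < n *)
  exists v : {perm 'I_n},
    range pi =
      [set P | P !=set0 /\
         exists2 i : 'I_n, (i.+1 < n)%N &
           P = \bigcup_(j in [set j : 'I_n | (i < j)%N])
                 parallel_class S (v i) (v j)].
Proof.
have [v ord] := part_ordering He HS Hpi Hblock.
exists v; apply/seteqP; split=> [_ [q _ <-]|P [[H PH] [i _ PE]]].
  split; first exact: part_nonempty Hpi q.
  have [H qH] := part_nonempty Hpi q.
  have [i [j [a [ij Sa HE]]]] := gain_arrangement_perm HS v (part_sub Hpi qH).
  have vij := perm_lt_neq v ij.
  exists i; first exact: leq_ltn_trans ij (ltn_ord j).
  apply: (part_eq_star HS Hpi ord ij (gain_edge HS vij Sa)).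
  by apply/(edge_partP HS Hpi _ vij Sa); rewrite -HE.
move: PH; rewrite PE => -[j /= ij [a Sa _]].
have vij := perm_lt_neq v ij.
have eij := gain_edge HS vij Sa.
have [q qij] := edge_part_some He HS Hpi eij.
by exists q => //; apply: (part_eq_star HS Hpi ord ij eij qij).
Qed.
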